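(* Let $f:\mathbb{R}^n\to\mathbb{R}$ be a quasiconvex $C^{1,1}$ function. Then the orbits of the gradient flow of $f$ are self-contracted curves.
   Context: A function $f:\mathbb{R}^n\to\mathbb{R}$ is quasiconvex if for every $y\in\mathbb{R}$ the sublevel set $\{x\in\mathbb{R}^n : f(x)\le y\}$ is convex. $C^{1,1}$ means that $f$ is $C^1$ and $\nabla f$ is Lipschitz continuous. An orbit of the gradient flow of $f$ is a maximal forward solution $\gamma:[0,T)\to\mathbb{R}^n$ (with $T\in(0,+\infty]$) of $\dot\gamma(t)=-\nabla f(\gamma(t))$, $t>0$, $\gamma(0)=x_0$, for some $x_0\in\mathbb{R}^n$. A curve $\gamma:I\to\mathbb{R}^n$ defined on an interval $I$ of $[0,+\infty)$ is called self-contracted if for all $t_1\le t_2\le t_3$ in $I$ one has $\mathrm{dist}(\gamma(t_1),\gamma(t_3))\ge\mathrm{dist}(\gamma(t_2),\gamma(t_3))$, where $\mathrm{dist}$ is the Euclidean distance. *)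

(* Defs.v *)
From HB Require Import structures.
From mathcomp Require Import all_boot all_order all_algebra.
From mathcomp Require Import all_classical all_reals all_analysis.
Set Implicit Arguments.
Unset Strict Implicit.
Unset Printing Implicit Defensive.
Import Order.TTheory GRing.Theory Num.Theory numFieldNormedType.Exports.
Local Open Scope classical_set_scope.
Local Open Scope ring_scope.

(* R^n is 'rV[R]_n. The library norm on matrices is the max norm, which induces
   the usual topology and derivatives but not the Euclidean distance, hence
   the definition of the latter here. *)
Definition edist (R : realType) (n : nat) (x y : 'rV[R]_n) : R :=
  Num.sqrt (\sum_(i < n) (x 0 i - y 0 i) ^+ 2).

Definition quasiconvex (R : realType) (n : nat) (f : 'rV[R]_n -> R) : Prop :=
  forall y : R, convex_set [set x : 'rV[R]_n | f x <= y].

Definition gradient (R : realType) (n : nat) (f : 'rV[R]_n -> R)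
    (x : 'rV[R]_n) : 'rV[R]_n :=
  \row_(i < n) 'D_(delta_mx 0 i) f x.

Definition C1 (R : realType) (n : nat) (f : 'rV[R]_n -> R) : Prop :=
  (forall x, differentiable f x) /\ continuous (gradient f).

Definition C11 (R : realType) (n : nat) (f : 'rV[R]_n -> R) : Prop :=
  C1 f /\
  exists K : R, forall x y, edist (gradient f x) (gradient f y) <= K * edist x y.

(* The interval [0, T) of R, where T may be +oo. *)
Definition time_interval (R : realType) (T : \bar R) : set R :=
  [set t : R | 0 <= t /\ (t%:E < T)%E].

(* Curves on [0, T) are total functions whose values outside of [0, T) are
   irrelevant. At t = 0, only (right) continuity is imposed. *)
Definition gradient_flow_solution (R : realType) (n : nat)
    (f : 'rV[R]_n -> R) (x0 : 'rV[R]_n) (T : \bar R) (gamma : R -> 'rV[R]_n) :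
    Prop :=
  [/\ gamma 0 = x0,
      {within time_interval T, continuous gamma} &
      forall t : R, 0 < t -> (t%:E < T)%E ->
        is_derive t 1 gamma (- gradient f (gamma t))].

Definition gradient_flow_orbit (R : realType) (n : nat)
    (f : 'rV[R]_n -> R) (T : \bar R) (gamma : R -> 'rV[R]_n) : Prop :=
  exists x0 : 'rV[R]_n,
    [/\ (0 < T)%E,
        gradient_flow_solution f x0 T gamma &
        forall (T' : \bar R) (gamma' : R -> 'rV[R]_n),
          (T < T')%E -> gradient_flow_solution f x0 T' gamma' ->
          ~ {in time_interval T, gamma' =1 gamma}].

Definition self_contracted (R : realType) (n : nat) (I : set R)
    (gamma : R -> 'rV[R]_n) : Prop :=
  forall t1 t2 t3 : R, I t1 -> I t2 -> I t3 -> t1 <= t2 -> t2 <= t3 ->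
    edist (gamma t1) (gamma t3) >= edist (gamma t2) (gamma t3).

(* Main.v *)
Require Import Defs.
From mathcomp Require Import all_boot all_order all_algebra.
From mathcomp Require Import all_classical all_reals all_analysis.
From mathcomp Require Import ring.
Set Implicit Arguments.
Unset Strict Implicit.
Unset Printing Implicit Defensive.
Import Order.TTheory GRing.Theory Num.Theory numFieldNormedType.Exports.
Local Open Scope classical_set_scope.
Local Open Scope ring_scope.

(** Write p = gamma t3. Self-contractedness says that the squared distance to
    p decreases along gamma up to time t3. Its derivative at time s is
    2 <gamma s - p, - grad f (gamma s)> = 2 <grad f (gamma s), p - gamma s>,
    that is, twice the derivative of f at gamma s in the direction of p.
    Since f decreases along its own gradient flow, f p <= f (gamma s), so that
    p lies in the sublevel set of f through gamma s. By quasiconvexity this set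
    contains the segment from gamma s to p, hence f does not increase when one
    leaves gamma s towards p, and the derivative is nonpositive
    ([quasiconvex_derive_le0]).

    Both monotonicity claims, for f and for the squared distance, are
    instances of [nonincreasing_along_curve], which differentiates the
    composition of a function with a curve. *)

(** The chain rule turns the pointwise inequality into a sign for the
    derivative of the composition of g and c, and the mean value theorem
    concludes. Differentiability of c is only asked for inside the interval,
    so that the lemma applies from time 0 on to a flow whose equation holds at
    positive times. *)
Lemma nonincreasing_along_curve (R : realType) (V : normedModType R)
    (g : V -> R) (c dc : R -> V) (a b : R) :
  (forall x, differentiable g x) -> a <= b ->
  {within `[a, b], continuous c} ->
  (forall t, t \in `]a, b[ -> is_derive t 1 c (dc t)) ->
  (forall t, t \in `]a, b[ -> 'D_(dc t) g (c t) <= 0) ->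
  g (c b) <= g (c a).
Proof.
move=> dg ab cc cdc dgle0.
have dct t : t \in `]a, b[ -> differentiable c t.
  by move=> /cdc ?; apply/derivable1_diffP.
have dgc t : t \in `]a, b[ -> differentiable (g \o c) t.
  by move=> /dct ?; exact: differentiable_comp.
suff : {in `[a, b]%R &, {homo g \o c : x y /~ x <= y}}.
  by apply; rewrite ?in_itv/= ?lexx ?ab.
apply: ler0_derive1_le_cc.
- by move=> t /dgc ?; apply/derivable1_diffP.
- move=> t tab; have cdct := cdc t tab.
  rewrite derive1E deriveE; last exact: dgc.
  rewrite diff_comp//=; last exact: dct.
  rewrite -[X in 'd g _ X]deriveE; last exact: dct.
  by rewrite derive_val -deriveE//; exact: dgle0.
- move=> t; apply: (@continuous_comp (subspace _) _ _ c g); first exact: cc.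
  exact/differentiable_continuous/dg.
Qed.

Lemma derive_gradientE (R : realType) (n : nat) (f : 'rV[R]_n -> R)
    (x v : 'rV[R]_n) :
  differentiable f x -> 'D_v f x = \sum_(i < n) v 0 i * gradient f x 0 i.
Proof.
move=> df; rewrite deriveE// [v in LHS]row_sum_delta linear_sum.
by apply: eq_bigr => i _; rewrite linearZ/= -deriveE// mxE.
Qed.

(** Coordinate projections are linear; reading the derivative of the identity
    entrywise gives their derivatives directly. *)
Lemma derive_coord (R : realType) (n : nat) (x v : 'rV[R]_n) (i : 'I_n) :
  is_derive x v (fun y : 'rV[R]_n => y 0 i) (v 0 i).
Proof.
apply: DeriveDef; first exact/diff_derivable/differentiable_coord.
have /derive_mx : derivable (id : 'rV[R]_n -> 'rV[R]_n) x v.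
  exact: derivable_id.
by rewrite derive_id => /rowP/(_ i); rewrite mxE.
Qed.

(** The square of the Euclidean distance, which unlike the distance is
    differentiable also at [z]. *)
Definition sqdist (R : realType) (n : nat) (z x : 'rV[R]_n) : R :=
  \sum_(i < n) (x 0 i - z 0 i) ^+ 2.

Lemma differentiable_sqdist (R : realType) (n : nat) (z x : 'rV[R]_n) :
  differentiable (sqdist z) x.
Proof.
rewrite (_ : sqdist z = \sum_(i < n)
    ((fun y : 'rV[R]_n => y 0 i) - cst (z 0 i)) ^+ 2); last first.
  by apply/funext => y; rewrite fct_sumE.
apply: differentiable_sum => i; apply: differentiableX; apply: differentiableB.
  exact: differentiable_coord.
exact: differentiable_cst.
Qed.

Lemma derive_sqdist (R : realType) (n : nat) (z x v : 'rV[R]_n) :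
  'D_v (sqdist z) x = 2 * \sum_(i < n) (x 0 i - z 0 i) * v 0 i.
Proof.
rewrite (_ : sqdist z = \sum_(i < n)
    ((fun y : 'rV[R]_n => y 0 i) - cst (z 0 i)) ^+ 2); last first.
  by apply/funext => y; rewrite fct_sumE.
have coordP i := @derive_coord R n x v i.
rewrite derive_val mulr_sumr; apply: eq_bigr => i _.
by rewrite -[LHS]/(_ * _) subr0 expr1 mulrA.
Qed.

(** The point at parameter h in [0, 1] of the segment from [x] to [y] is a
    convex combination of two points of the sublevel set at level [f x], so all
    difference quotients with small h > 0 are nonpositive. Only right-sided
    quotients have a sign; they suffice because the derivative exists. *)
Lemma quasiconvex_derive_le0 (R : realType) (n : nat) (f : 'rV[R]_n -> R)
    (x y : 'rV[R]_n) :
  quasiconvex f -> differentiable f x -> f y <= f x -> 'D_(y - x) f x <= 0.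
Proof.
move=> qf df fyx.
have cvD : h^-1 *: (f (h *: (y - x) + x) - f x) @[h --> 0^'+]
    --> 'D_(y - x) f x.
  by apply: cvg_dnbhs_at_right; exact: diff_derivable.
apply: (cvgr_to_le cvD); near=> h.
have h0 : 0 <= h by near: h; exact: nbhs_right_ge.
have h1 : h <= 1 by near: h; exact: nbhs_right_le.
have : (conv (Itv01 h0 h1) (y : convex_lmodType _) x) \in
    [set z | f z <= f x].
  by apply: qf; rewrite inE/=.
rewrite inE/=.
have -> : conv (Itv01 h0 h1) (y : convex_lmodType _) x = h *: (y - x) + x.
  rewrite [LHS](_ : _ = h *: y + (1 - h) *: x)//.
  by rewrite scalerBl scale1r scalerBr addrA addrAC.
by move=> fle; rewrite mulr_ge0_le0// ?invr_ge0// subr_le0.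
Unshelve. all: by end_near. Qed.

Theorem proposition6p2 (R : realType) (n : nat) (f : 'rV[R]_n -> R)
    (f_quasiconvex : quasiconvex f) (f_C11 : C11 f)
    (T : \bar R) (gamma : R -> 'rV[R]_n)
    (gamma_orbit : gradient_flow_orbit f T gamma) :
  self_contracted (time_interval T) gamma.
Proof.
have [[df _] _] := f_C11; have [x0 [_ [_ cgamma dgamma] _]] := gamma_orbit.
move=> t1 t2 t3 [t1_ge0 _] _ [_ t3T] t12 t23.
have sub a : 0 <= a -> `[a, t3] `<=` time_interval T.
  move=> a0 t /=; rewrite in_itv/= => /andP[at_ tt3]; split.
    exact: le_trans at_.
  by apply: le_lt_trans t3T; rewrite lee_fin.
have cgammaW a b : 0 <= a -> b <= t3 -> {within `[a, b], continuous gamma}.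
  move=> a0 bt3; apply: continuous_subspaceW cgamma.
  apply: subset_trans (sub a a0); exact: subset_itvl.
have flow a b : 0 <= a -> b <= t3 -> forall t, t \in `]a, b[ ->
    is_derive t 1 gamma (- gradient f (gamma t)).
  move=> a0 bt3 t; rewrite in_itv/= => /andP[at_ tb].
  apply: dgamma; first exact: le_lt_trans at_.
  by apply: le_lt_trans t3T; rewrite lee_fin (le_trans (ltW tb)).
have f_noninc t : 0 <= t -> t <= t3 -> f (gamma t3) <= f (gamma t).
  move=> t0 tt3.
  apply: (nonincreasing_along_curve df tt3 (cgammaW _ _ t0 (lexx _))
           (flow _ _ t0 (lexx _))) => s _.
  (* The derivative of f along the flow is - |grad f|^2. *)
  rewrite derive_gradientE// sumr_le0// => i _.
  by rewrite mxE mulNr oppr_le0 -expr2 sqr_ge0.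
rewrite /edist ler_wsqrtr//.
apply: (nonincreasing_along_curve (@differentiable_sqdist R n (gamma t3)) t12
  (cgammaW _ _ t1_ge0 t23) (flow _ _ t1_ge0 t23)) => s.
rewrite in_itv/= => /andP[t1s st2].
have s0 : 0 <= s by rewrite (le_trans t1_ge0)// ltW.
have st3 : s <= t3 by rewrite (le_trans (ltW st2)).
rewrite derive_sqdist pmulr_rle0//.
have := quasiconvex_derive_le0 f_quasiconvex (df (gamma s))
  (f_noninc s s0 st3).
rewrite derive_gradientE//; congr (_ <= 0); apply: eq_bigr => i _.
by rewrite !mxE; ring.
Qed.
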